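(* Let $k\ge3$ and let $P$ be the uniform distribution on the boundary $L$ of the regular polygon with $k$ sides inscribed in the unit circle, with density $\frac1k$ with respect to arc length, and let the conditional set $\beta$ be the set of its $k$ vertices. Let $V_n$ ($n\ge k$) denote the $n$th conditional quantization error and $V_\infty=\lim_{n\to\infty}V_n$. Then the conditional quantization dimension $$D(P)=\lim_{n\to\infty}\frac{2\log n}{-\log(V_n-V_\infty)}$$ exists and equals $1$, and the $D(P)$-dimensional conditional quantization coefficient $$\lim_{n\to\infty}n^{2/D(P)}(V_n-V_\infty)=\lim_{n\to\infty}n^{2}(V_n-V_\infty)$$ exists as a finite positive number and equals $\frac23k^2\sin^3\frac{\pi}{k}$.
   Context: For $k\ge3$, the regular $k$-gon inscribed in the unit circle centered at the origin has vertices $A_j=\big(\sin\frac{\pi(2j-3)}{k},-\cos\frac{\pi(2j-3)}{k}\big)$, $1\le j\le k$, with $A_{k+1}=A_1$; $L_j$ is the side (closed segment) $A_jA_{j+1}$ and $L=\bigcup_{j=1}^kL_j$. The uniform distribution $P$ on $L$ is, in the paper's normalization, the Borel measure on $\mathbb R^2$ supported on $L$ with constant density $\frac1k$ with respect to arc length on $L$ (its total mass is $2\sin\frac{\pi}{k}$). The conditional set is $\beta=\{A_j:1\le j\le k\}$. With $d$ the Euclidean metric, for $n\ge k$ the $n$th conditional quantization error is $$V_n=\inf\Big\{\int\min_{a\in\alpha\cup\beta}d(x,a)^2\,dP(x):\alpha\subseteq\mathbb R^2,\ 0\le\mathrm{card}(\alpha)\le n-k\Big\}.$$ *)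

(* Defs.v *)
From HB Require Import structures.
From mathcomp Require Import all_boot all_order all_algebra.
From mathcomp Require Import finmap.
From mathcomp Require Import all_classical all_reals all_analysis.
From mathcomp Require Import measurable_realfun.

Set Implicit Arguments.
Unset Strict Implicit.
Unset Printing Implicit Defensive.

Import Order.TTheory GRing.Theory Num.Theory.
Import numFieldNormedType.Exports.

Local Open Scope classical_set_scope.
Local Open Scope ring_scope.

(* The canonical norm of [R * R] is the sup norm, hence this definition. *)
Definition euclid (R : realType) (x y : R * R) : R :=
  Num.sqrt ((x.1 - y.1) ^+ 2 + (x.2 - y.2) ^+ 2).

Section ArcLength.
Variables (R : realType) (a b : R * R).

(* Unit-speed parametrization of the line through [a] and [b] (for a <> b),
   with [a] at time 0 and [b] at time [euclid a b]. *)
Definition segment_param (s : measurableTypeR R) : R * R :=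
  (a.1 + s * ((b.1 - a.1) / euclid a b), a.2 + s * ((b.2 - a.2) / euclid a b)).

Lemma measurable_segment_param : measurable_fun [set: measurableTypeR R] segment_param.
Proof.
apply/measurable_fun_pairP; split => /=; apply: measurable_funD => //;
exact: measurable_funM.
Qed.

(* Arc length carried by the closed segment from [a] to [b], as a Borel measure
   on the plane; [R * R] has the product sigma-algebra, i.e. the Borel one. *)
Definition segment_length : set (R * R) -> \bar R :=
  pushforward
    (mrestr (@lebesgue_measure R) (measurable_itv `[0, euclid a b]))
    segment_param.

Let mparam := measurable_segment_param.

Let segment_length0 : segment_length set0 = 0%E.
Proof. exact: measure0. Qed.

Let segment_length_ge0 A : (0 <= segment_length A)%E.
Proof. exact: measure_ge0. Qed.

Let segment_length_sigma_additive : semi_sigma_additive segment_length.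
Proof. exact: measure_semi_sigma_additive. Qed.

HB.instance Definition _ := isMeasure.Build _ _ _ segment_length
  segment_length0 segment_length_ge0 segment_length_sigma_additive.

End ArcLength.

Section RegularPolygon.
Variables (R : realType) (k : nat).

(* A_j for 1 <= j <= k; A_{k+1} = A_1 holds by periodicity. *)
Definition vertex (j : nat) : R * R :=
  let theta := pi * (2 * j%:R - 3) / k%:R in (sin theta, - cos theta).

Definition vertices : {fset (R * R)} := [fset vertex j | j in iota 1 k]%fset.

(* Arc length on L; the sum runs over the sides A_j A_{j+1} with j = i + 1,
   i < k, which overlap only in null sets. *)
Definition perimeter_measure : {measure set (R * R) -> \bar R} :=
  msum (fun i => segment_length (vertex i.+1) (vertex i.+2)) k.

Definition polygon_measure : {measure set (R * R) -> \bar R} :=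
  mscale (k%:R^-1)%:nng perimeter_measure.

(* The minimum of d(x, a)^2 over a in alpha `|` beta; the default value of the
   iterated minimum is the term of A_1, which belongs to beta. *)
Definition min_sq_dist (alpha : {fset (R * R)}) (x : R * R) : R :=
  \big[Num.min/euclid x (vertex 1) ^+ 2]_(a <- (alpha `|` vertices)%fset)
     euclid x a ^+ 2.

(* V_n, meaningful for n >= k. *)
Definition cond_quant_error (n : nat) : R :=
  fine (ereal_inf
    [set (\int[polygon_measure]_x (min_sq_dist alpha x)%:E)%E
    | alpha in [set alpha : {fset (R * R)} | (#|` alpha| <= n - k)%N]]).

Definition cond_quant_error_lim : R := limn cond_quant_error.

Definition cond_quant_dim_seq (n : nat) : R :=
  2 * ln n%:R / - ln (cond_quant_error n - cond_quant_error_lim).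

Definition cond_quant_dim : R := limn cond_quant_dim_seq.

End RegularPolygon.

(* Main.v *)
Require Import Defs.
From HB Require Import structures.
From mathcomp Require Import all_boot all_order all_algebra.
From mathcomp Require Import finmap ring lra.
From mathcomp Require Import all_classical all_reals all_analysis.
From mathcomp Require Import measurable_realfun.

Set Implicit Arguments.
Unset Strict Implicit.
Unset Printing Implicit Defensive.

Import Order.TTheory GRing.Theory Num.Theory.
Import numFieldNormedType.Exports.

Local Open Scope classical_set_scope.
Local Open Scope ring_scope.

(* The limit V_inf is 0 and both bounds on n^2 V_n are elementary.

   Upper bound: put the midpoints of M equal cells on every side, with kM + k <= n;
   each cell of length l/M contributes (l/M)^3 / 12, where l = 2 sin (pi/k).

   Lower bound: for r > 0 the minimum of |x - a|^2 over the n points a is at least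
   r^2 - \sum_a (r^2 - |x - a|^2)_+, and on a line the integral of each bump
   (r^2 - |x - a|^2)_+ is at most 4/3 r^3.  Integrate over the sides shortened by d
   at both ends: these are at mutual distance at least 2 d sin (pi/k) cos (pi/k), so
   for r of order d each bump meets only one of them.  The optimal r ~ k l / (2 n)
   yields k^2 (l - 2 d)^3 / (12 n^2), and d may be taken of order 1/n. *)

(** * Integration tools: restricted measures and explicit integrals on the line *)

Lemma ge0_integral_mrestr (d : measure_display) (T : measurableType d)
    (R : realType) (mu : {measure set T -> \bar R}) (D : set T)
    (mD : measurable D) (f : T -> \bar R) :
  measurable_fun [set: T] f -> (forall x, (0 <= f x)%E) ->
  (\int[mrestr mu mD]_x f x = \int[mu]_(x in D) f x)%E.
Proof.
move=> mf f0.
(* The complement of [D] is null for the restricted measure, and on subsets of [D] the two measures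
   agree. *)
rewrite -(setUv D) ge0_integral_setU//; last 3 first.
- exact: measurableC.
- by rewrite setUv.
- by apply/disj_setPS; rewrite setICr.
rewrite [X in (_ + X)%E]null_set_integral//; last 3 first.
- exact: measurableC.
- exact: measurable_funTS.
- by rewrite /= /mrestr setICl measure0.
rewrite adde0.
by apply: eq_measure_integral => A mA AD; rewrite /= /mrestr setIidl.
Qed.

Lemma integral_is_derive (R : realType) (F f : R -> R) (a b : R) :
  a < b -> (forall x : R, is_derive x 1 F (f x)) -> continuous f ->
  (\int[@lebesgue_measure R]_(x in `[a, b]) (f x)%:E = (F b - F a)%:E)%E.
Proof.
move=> ab dF cf; rewrite (@continuous_FTC2 _ _ F)//.
- exact: continuous_subspaceT.
- have cF x : {for x, continuous F}.
    by apply: differentiable_continuous; apply/derivable1_diffP; exact: ex_derive.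
  split => [x _||]; first exact: ex_derive.
    by apply: cvg_at_right_filter; exact: cF.
  by apply: cvg_at_left_filter; exact: cF.
- by move=> x _; rewrite derive1E; exact: derive_val.
Qed.

Lemma continuous_sqr_sub (R : realType) (c : R) :
  continuous (fun x : R => (x - c) ^+ 2).
Proof.
by move=> x; apply: (@cvg_comp _ _ _ (fun x => x - c) (fun y => y ^+ 2));
  [apply: cvgB; [exact: cvg_id|exact: cvg_cst]|exact: exprn_continuous].
Qed.

Lemma integral_sqr_sub (R : realType) (a b c : R) : a < b ->
  (\int[@lebesgue_measure R]_(x in `[a, b]) ((x - c) ^+ 2)%R%:E =
   (((b - c) ^+ 3 - (a - c) ^+ 3) / 3)%:E)%E.
Proof.
move=> ab.
have dF (x : R) : is_derive x 1 (fun y => (y - c) ^+ 3 / 3) ((x - c) ^+ 2).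
  by apply: is_derive_eq; rewrite /GRing.scale/=; field.
by rewrite (integral_is_derive ab dF (@continuous_sqr_sub _ c)) mulrBl.
Qed.

Lemma integral_bump (R : realType) (r c : R) : 0 < r ->
  (\int[@lebesgue_measure R]_(x in `[(c - r)%R, (c + r)%R]) (r ^+ 2 - (x - c) ^+ 2)%R%:E =
   (4 / 3 * r ^+ 3)%:E)%E.
Proof.
move=> r0.
have dF (x : R) : is_derive x 1 (fun y => r ^+ 2 * y - (y - c) ^+ 3 / 3)
    (r ^+ 2 - (x - c) ^+ 2).
  by apply: is_derive_eq; rewrite /GRing.scale/=; field.
rewrite (integral_is_derive _ dF); first by congr EFin; field.
  lra.
by move=> x; apply: cvgB; [exact: cvg_cst|exact: continuous_sqr_sub].
Qed.

(** * Plane geometry: coordinates along a side and the gap between trimmed sides *)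

Lemma euclid_sqr (R : realType) (x y : R * R) :
  euclid x y ^+ 2 = (x.1 - y.1) ^+ 2 + (x.2 - y.2) ^+ 2.
Proof. by rewrite sqr_sqrtr// addr_ge0// sqr_ge0. Qed.

(* With w = pi/k and x = (i - j) pi/k, the right-hand side is the distance from the
   line of side i to the point of side j at signed distance t from its midpoint. *)
Lemma side_gap (R : realType) (w x t d : R) : 0 < w -> w < pi / 2 ->
  w <= x -> x <= pi - w -> 0 <= d -> `|t| <= sin w - d ->
  2 * d * cos w * sin w <= cos w * (1 - cos (2 * x)) - t * sin (2 * x).
Proof.
move=> w0 wpi wx xw d0 tw.
have pi0 := pi_gt0 R.
have s0 : 0 < sin w by rewrite sin_gt0_pihalf// w0.
have c0 : 0 < cos w by rewrite cos_gt0_pihalf// wpi andbT; lra.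
have A0 : 0 <= sin (x + w) by rewrite sin_ge0_pi//; apply/andP; split; lra.
have B0 : 0 <= sin (x - w) by rewrite sin_ge0_pi//; apply/andP; split; lra.
(* Sum-to-product: [sin x - sin w] is twice [cos ((x + w) / 2) * sin ((x - w) / 2)], and both
   factors are nonnegative. *)
have sS : sin w <= sin x.
  have -> : x = (x + w) / 2 + (x - w) / 2 by field.
  have {1}-> : w = (x + w) / 2 - (x - w) / 2 by field.
  rewrite sinB sinD.
  have : 0 <= cos ((x + w) / 2) * sin ((x - w) / 2).
    by rewrite mulr_ge0 ?cos_ge0_pihalf ?sin_ge0_pi//; apply/andP; split; lra.
  lra.
rewrite !mulr_natl cos_mulr2n sin_mulr2n.
move: A0 B0; rewrite sinD sinB.
have := cos2Dsin2 x.
set S := sin x in sS *; set C := cos x.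
set s := sin w in tw s0 sS *; set c := cos w in c0 *.
move=> CS A0 B0; have {}CS : C ^+ 2 = 1 - S ^+ 2 by rewrite -CS; ring.
have {}tw : - (s - d) <= t /\ t <= s - d by apply/andP; rewrite -ler_norml.
have [tl tr] := tw.
have dc : 0 <= d * c by rewrite mulr_ge0// ltW.
have dcs : 0 <= (S - s) * (d * c) by rewrite mulr_ge0// subr_ge0.
have S0 : 0 <= S by rewrite (le_trans (ltW s0)).
(* The right-hand side of the goal equals [2 * S * (c * S - t * C)], so [key] and [s <= S] suffice.
   For [key] times [s], add the two products below: each pairs a bound on [t] with the sign of
   [sin (x + w)] or [sin (x - w)]. *)
have key : d * c <= c * S - t * C.
  rewrite -(ler_pM2l s0).
  have : 0 <= (s - t - d) * (S * c + C * s) by rewrite mulr_ge0//; lra.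
  have : 0 <= (s + t - d) * (S * c - C * s) by rewrite mulr_ge0//; lra.
  lra.
have : 0 <= S * (c * S - t * C - d * c) by rewrite mulr_ge0// subr_ge0.
rewrite CS; lra.
Qed.

Definition half_angle (R : realType) (k : nat) : R := pi / k%:R.

(* The foot of the perpendicular from the center to the side A_{i+1} A_{i+2} is
   at angle [mid_angle i], and the side spans angles [mid_angle i -+ half_angle]. *)
Definition mid_angle (R : realType) (k i : nat) : R := 2 * i%:R * half_angle R k.

Definition side (R : realType) (k i : nat) : R -> R * R :=
  segment_param (vertex R k i.+1) (vertex R k i.+2).

Section Geometry.
Variables (R : realType) (k : nat).
Hypothesis k3 : (3 <= k)%N.

Local Notation w := (half_angle R k).
Local Notation mid := (mid_angle R k).
Let kR : (3 : R) <= k%:R. Proof. by rewrite (ler_nat _ 3). Qed.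
Let k0 : (0 : R) < k%:R. Proof. by rewrite (lt_le_trans _ kR). Qed.

Lemma half_angle_gt0 : 0 < w.
Proof. by rewrite divr_gt0// pi_gt0. Qed.

Lemma half_angle_lt : w < pi / 2.
Proof. by rewrite ltr_pM2l ?pi_gt0// ltf_pV2 ?posrE// (lt_le_trans _ kR)// ltr_nat. Qed.

Lemma sin_half_angle_gt0 : 0 < sin w.
Proof. by rewrite sin_gt0_pihalf// half_angle_gt0 half_angle_lt. Qed.

Lemma cos_half_angle_gt0 : 0 < cos w.
Proof.
rewrite cos_gt0_pihalf// half_angle_lt andbT (lt_trans _ half_angle_gt0)//.
by rewrite oppr_lt0 divr_gt0// pi_gt0.
Qed.

Let vertexE i : vertex R k i.+1 = (sin (mid i - w), - cos (mid i - w)).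
Proof.
have -> : mid i - w = pi * (2 * i.+1%:R - 3) / k%:R.
  by rewrite /mid_angle /half_angle -natr1; field; rewrite gt_eqF.
by [].
Qed.

Let vertexSE i : vertex R k i.+2 = (sin (mid i + w), - cos (mid i + w)).
Proof.
have -> : mid i + w = pi * (2 * i.+2%:R - 3) / k%:R.
  by rewrite /mid_angle /half_angle -!natr1; field; rewrite gt_eqF.
by [].
Qed.

Lemma euclid_side i : euclid (vertex R k i.+1) (vertex R k i.+2) = 2 * sin w.
Proof.
rewrite /euclid vertexE vertexSE/= !(sinB, sinD, cosB, cosD).
set S := sin (mid i); set C := cos (mid i).
have SC : C ^+ 2 + S ^+ 2 = 1 by exact: cos2Dsin2.
rewrite (_ : _ + _ = (2 * sin w) ^+ 2).
  by rewrite sqrtr_sqr ger0_norm// mulr_ge0// ltW// sin_half_angle_gt0.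
have -> : (2 * sin w) ^+ 2 = (2 * sin w) ^+ 2 * (C ^+ 2 + S ^+ 2) by rewrite SC mulr1.
by ring.
Qed.

Lemma sideE i s : side k i s =
  (cos w * sin (mid i) + (s - sin w) * cos (mid i),
   (s - sin w) * sin (mid i) - cos w * cos (mid i)).
Proof.
have s0 : sin w != 0 by rewrite gt_eqF// sin_half_angle_gt0.
rewrite /side /segment_param euclid_side vertexE vertexSE/= !(sinB, sinD, cosB, cosD).
by congr pair; field.
Qed.

(* Coordinates of [a] relative to side i: [foot] is the arc-length parameter of its
   orthogonal projection, [height] its distance to the line of the side, counted
   positively towards the center. *)
Definition foot (i : nat) (a : R * R) : R :=
  sin w + a.1 * cos (mid i) + a.2 * sin (mid i).

Definition height (i : nat) (a : R * R) : R :=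
  cos w - (a.1 * sin (mid i) - a.2 * cos (mid i)).

Lemma euclid_sqr_side i s a : euclid (side k i s) a ^+ 2 =
  (s - foot i a) ^+ 2 + height i a ^+ 2.
Proof.
rewrite euclid_sqr sideE /foot /height /=.
have := cos2Dsin2 (mid i).
set S := sin (mid i); set C := cos (mid i); set h := cos w; set t := s - sin w => SC.
have -> : s - (sin w + a.1 * C + a.2 * S) = t - (a.1 * C + a.2 * S).
  by rewrite /t; ring.
apply/eqP; rewrite -subr_eq0.
set E := (X in X == 0).
have -> : E = (C ^+ 2 + S ^+ 2 - 1) * (h ^+ 2 + t ^+ 2 - a.1 ^+ 2 - a.2 ^+ 2).
  by rewrite /E; ring.
by rewrite SC subrr mul0r.
Qed.

(** The height is 1-Lipschitz: the difference of two heights is the scalar product of [b - a] with a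
    unit normal of side i. Lagrange's identity exhibits the defect as a square. *)
Lemma height_sub_sqr_le i a b : (height i a - height i b) ^+ 2 <= euclid b a ^+ 2.
Proof.
rewrite euclid_sqr /height -subr_ge0.
have := cos2Dsin2 (mid i); set S := sin (mid i); set C := cos (mid i) => SC.
set x := b.1 - a.1; set y := b.2 - a.2.
have -> : cos w - (a.1 * S - a.2 * C) - (cos w - (b.1 * S - b.2 * C)) = x * S - y * C.
  by rewrite /x /y; ring.
have -> : x ^+ 2 + y ^+ 2 = (x ^+ 2 + y ^+ 2) * (C ^+ 2 + S ^+ 2).
  by rewrite SC mulr1.
have -> : (x ^+ 2 + y ^+ 2) * (C ^+ 2 + S ^+ 2) - (x * S - y * C) ^+ 2 =
  (x * C + y * S) ^+ 2 by ring.
exact: sqr_ge0.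
Qed.

(** This has the shape of the right-hand side of [side_gap], with [2 * x] the difference of the mid
    angles and [t] recentered at the midpoint of side j. *)
Lemma height_side i j t :
  height i (side k j t) = cos w * (1 - cos (mid i - mid j)) -
                           (t - sin w) * sin (mid i - mid j).
Proof. by rewrite /height sideE/= cosB sinB; ring. Qed.

(** If [a] were within [r] of both points, its height over side i would be below [r], so the point
    on side j would have height below [2 * r]. By [side_gap] that height is at least
    [2 * d * cos w * sin w], hence at least [2 * r]. *)
Lemma trimmed_sides_far i j a s t d r : (i < k)%N -> (j < k)%N -> i != j ->
  0 <= d -> 0 <= r -> r <= d * cos w * sin w ->
  s \in `[d, 2 * sin w - d] -> t \in `[d, 2 * sin w - d] ->
  euclid (side k i s) a ^+ 2 < r ^+ 2 -> euclid (side k j t) a ^+ 2 < r ^+ 2 ->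
  False.
Proof.
wlog ji : i j s t / (j < i)%N.
  move=> wl ik jk ij; move: (ij); rewrite neq_ltn => /orP[|] ij'.
    move=> d0 r0 rd sd td sr tr.
    by apply: (wl j i t s) => //; rewrite eq_sym.
  exact: wl.
move=> ik jk _ d0 r0 rd _; rewrite in_itv/= => /andP[dt td] ia ja.
have : 2 * d * cos w * sin w <= height i (side k j t).
  rewrite height_side.
  have -> : mid i - mid j = 2 * ((i - j)%:R * w).
    by rewrite /mid_angle natrB ?(ltnW ji)//; ring.
  (* From [1 <= i - j <= k - 1] the angle [(i - j) * w] lies between [w] and [pi - w], as [side_gap]
     requires. *)
  have kw : k%:R * w = pi by rewrite /half_angle; field; rewrite gt_eqF.
  apply: side_gap => //.
  - exact: half_angle_gt0.
  - exact: half_angle_lt.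
  - by rewrite ler_peMl ?(ltW half_angle_gt0)// ler1n subn_gt0.
  - rewrite -kw lerBrDr -[X in _ + X]mul1r -mulrDl ler_pM2r ?half_angle_gt0//.
    by rewrite natr1 ler_nat (leq_ltn_trans _ ik)// leq_subr.
  - by rewrite ler_norml; apply/andP; split; lra.
have ha : height i a ^+ 2 < r ^+ 2.
  by rewrite (le_lt_trans _ ia)// euclid_sqr_side lerDr sqr_ge0.
have hb := le_lt_trans (height_sub_sqr_le i a (side k j t)) ja.
have sqr_lt x : x ^+ 2 < r ^+ 2 -> - r < x /\ x < r.
  move=> xr; apply/andP; rewrite -ltr_norml; move: xr.
  by rewrite -[x ^+ 2]real_normK ?num_real// ltr_pXn2r ?nnegrE.
have [? ?] := sqr_lt _ ha; have [? ?] := sqr_lt _ hb.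
lra.
Qed.

End Geometry.

(** * Integrals over the polygon, side by side *)

Section PolygonIntegral.
Variables (R : realType) (k : nat).
Hypothesis k3 : (3 <= k)%N.
Local Notation w := (half_angle R k).
Local Notation lebesgue := (@lebesgue_measure R).

Lemma measurable_side i : measurable_fun [set: measurableTypeR R] (@side R k i).
Proof. exact: measurable_segment_param. Qed.

Lemma integral_polygon (f : R * R -> \bar R) :
  measurable_fun [set: R * R] f -> (forall x, (0 <= f x)%E) ->
  (\int[polygon_measure R k]_x f x =
   (k%:R^-1)%:E * \sum_(i < k) \int[lebesgue]_(s in `[0%R, (2 * sin w)%R])
     f (side k i s))%E.
Proof.
move=> mf f0; rewrite ge0_integral_mscale//= ge0_integral_measure_sum//.
congr (_ * _)%E; apply: eq_bigr => i _.
rewrite [LHS](ge0_integral_pushforward (measurable_side i))//.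
rewrite preimage_setT ge0_integral_mrestr ?euclid_side//.
  by apply: measurableT_comp => //; exact: measurable_side.
by move=> x; exact: f0.
Qed.

Lemma measurable_euclid_sqr (a : R * R) :
  measurable_fun [set: R * R] (fun x => euclid x a ^+ 2).
Proof.
under eq_fun do rewrite euclid_sqr.
by apply: measurable_funD; apply: measurable_funX; apply: measurable_funB.
Qed.

Lemma measurable_min_sq_dist alpha :
  measurable_fun [set: R * R] (min_sq_dist k alpha).
Proof.
rewrite /min_sq_dist; elim: (enum_fset _) => [|a s ih].
  by under eq_fun do rewrite big_nil; exact: measurable_euclid_sqr.
under eq_fun do rewrite big_cons.
by apply: measurable_minr => //; exact: measurable_euclid_sqr.
Qed.

Lemma min_sq_dist_le alpha (x a : R * R) : a \in alpha ->
  min_sq_dist k alpha x <= euclid x a ^+ 2.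
Proof. by move=> aa; apply: ge_bigmin_seq => //; rewrite inE aa. Qed.

Lemma min_sq_dist_attained alpha (x : R * R) :
  exists2 a, a \in (alpha `|` vertices R k)%fset &
    min_sq_dist k alpha x = euclid x a ^+ 2.
Proof.
(* The iterated minimum starts from the term of [vertex 1], so attainment in the empty case of the
   induction rests on this membership. *)
have v1 : vertex R k 1 \in (alpha `|` vertices R k)%fset.
  rewrite inE; apply/orP; right; apply/imfsetP; exists 1%N => //=.
  by rewrite mem_iota/= add1n ltnS (leq_trans _ k3).
have attained (s : seq (R * R)) : {subset s <= (alpha `|` vertices R k)%fset} ->
    exists2 a, a \in (alpha `|` vertices R k)%fset &
      \big[Num.min/euclid x (vertex R k 1) ^+ 2]_(b <- s) euclid x b ^+ 2 =
      euclid x a ^+ 2; last exact: attained.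
elim: s => [|a s ih] sub.
  by exists (vertex R k 1) => //; rewrite big_nil.
rewrite big_cons minEle; case: ifP => _.
  by exists a => //; apply: sub; rewrite inE eqxx.
by apply: ih => y ys; apply: sub; rewrite inE ys orbT.
Qed.

Lemma min_sq_dist_ge0 alpha (x : R * R) : 0 <= min_sq_dist k alpha x.
Proof. by have [a _ ->] := min_sq_dist_attained alpha x; exact: sqr_ge0. Qed.

Lemma card_vertices : (#|` vertices R k| <= k)%N.
Proof.
rewrite -[leqRHS](size_iota 1 k) -(size_map (vertex R k)).
apply: uniq_leq_size => [|x]; first exact: fset_uniq.
by move=> /imfsetP[j /= jk ->]; exact: map_f.
Qed.

Lemma measurable_comp_side (f : R * R -> R) i (D : set (measurableTypeR R)) :
  measurable_fun [set: R * R] f ->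
  measurable_fun D (fun s : measurableTypeR R => (f (side k i s))%:E).
Proof.
move=> mf; apply/measurable_EFinP; apply: measurable_funTS.
by apply: (measurableT_comp mf); exact: measurable_side.
Qed.

(** * Lower bound on the error by bumps *)

Definition bump (r : R) (a x : R * R) : R := Num.max (r ^+ 2 - euclid x a ^+ 2) 0.

Lemma bump_ge0 r a x : 0 <= bump r a x.
Proof. by rewrite le_max lexx orbT. Qed.

Lemma measurable_bump r a : measurable_fun [set: R * R] (bump r a).
Proof.
apply: measurable_maxr => //; apply: measurable_funB => //.
exact: measurable_euclid_sqr.
Qed.

(** Dropping the height of [a] over the side only increases the bump. What remains is a
    one-dimensional bump centered at the foot of [a], which vanishes farther than [r] from it, so
    its integral over the whole line is the one in [integral_bump]. *)
Lemma integral_bump_side_le r a i (D : set R) : 0 < r -> measurable D ->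
  (\int[lebesgue]_(s in D) (bump r a (side k i s))%:E <= (4 / 3 * r ^+ 3)%:E)%E.
Proof.
move=> r0 mD; set c := foot k i a.
pose g (s : R) := (Num.max (r ^+ 2 - (s - c) ^+ 2) 0)%:E.
have g0 s : (0 <= g s)%E by rewrite lee_fin le_max lexx orbT.
have mg : measurable_fun [set: R] g.
  apply/measurable_EFinP; apply: measurable_maxr => //; apply: measurable_funB => //.
  by apply: measurable_funX; apply: measurable_funB.
apply: (@le_trans _ _ (\int[lebesgue]_(s in D) g s)%E).
  apply: ge0_le_integral => //.
  - by move=> s _; rewrite lee_fin bump_ge0.
  - exact: measurable_comp_side (measurable_bump _ _).
  - exact: measurable_funTS.
  - move=> s _; rewrite lee_fin /bump euclid_sqr_side// -/c.
    have := sqr_ge0 (height k i a).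
    by rewrite ge_max !le_max lexx orbT andbT => h; apply/orP; left; lra.
apply: (@le_trans _ _ (\int[lebesgue]_s g s)%E); first exact: ge0_subset_integral.
rewrite -(integral_bump c r0) [leRHS]integral_mkcond.
apply: ge0_le_integral => //.
- apply: (proj1 (measurable_restrictT _ _)) => //; apply: measurable_funTS.
  apply/measurable_EFinP.
  apply: measurable_funB => //.
  by apply: measurable_funX; apply: measurable_funB.
- move=> s _; rewrite /patch; case: ifPn.
    rewrite inE/= in_itv/= => /andP[h1 h2].
    by rewrite lee_fin ge_max lexx/=; nra.
  rewrite notin_setE/= in_itv/= => /negP; rewrite negb_and -!ltNge => h.
  by rewrite lee_fin ge_max lexx andbT; case/orP: h => h; nra.
Qed.

(** By [trimmed_sides_far] at most one trimmed side comes within [r] of [a], so at most one term is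
    nonzero. *)
Lemma sum_integral_bump_le r d a : 0 < r -> 0 <= d -> r <= d * cos w * sin w ->
  (\sum_(i < k) \int[lebesgue]_(s in `[d, (2 * sin w - d)%R])
     (bump r a (side k i s))%:E <= (4 / 3 * r ^+ 3)%:E)%E.
Proof.
move=> r0 d0 rd.
have bump0 (i : 'I_k) : (forall s, s \in `[d, 2 * sin w - d] ->
      r ^+ 2 <= euclid (side k i s) a ^+ 2) ->
    (\int[lebesgue]_(s in `[d, (2 * sin w - d)%R]) (bump r a (side k i s))%:E = 0)%E.
  move=> far; apply: integral0_eq => s /= sd; congr EFin.
  by apply/max_idPr; rewrite subr_le0 far.
have [[i [s sd near_i]]|none] :=
  pselect (exists i : 'I_k, exists2 s, s \in `[d, 2 * sin w - d] &
             euclid (side k i s) a ^+ 2 < r ^+ 2).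
  rewrite (bigD1 i)//= big1 ?adde0; first exact: integral_bump_side_le.
  move=> j ji; apply: bump0 => t td; rewrite leNgt; apply/negP => near_j.
  by have := trimmed_sides_far k3 (ltn_ord j) (ltn_ord i) ji d0 (ltW r0) rd td sd
    near_j near_i.
rewrite big1 ?lee_fin ?mulr_ge0 ?exprn_ge0 ?(ltW r0)// => i _.
by apply: bump0 => s sd; rewrite leNgt; apply/negP => h; apply: none; exists i, s.
Qed.

(** The bump of a nearest point alone makes up the difference; the other bumps are nonnegative. *)
Lemma le_min_sq_distD_bump r alpha x :
  r ^+ 2 <= min_sq_dist k alpha x + \sum_(a <- (alpha `|` vertices R k)%fset) bump r a x.
Proof.
have [a aA ->] := min_sq_dist_attained alpha x.
rewrite -lerBlDl (big_fsetD1 a)//=.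
have : 0 <= \sum_(b <- ((alpha `|` vertices R k) `\ a)%fset) bump r b x.
  by apply: sumr_ge0 => b _; exact: bump_ge0.
have : r ^+ 2 - euclid x a ^+ 2 <= bump r a x by rewrite le_max lexx.
lra.
Qed.

Lemma integral_min_sq_dist_ge alpha n r d : (#|` alpha| + k <= n)%N ->
  0 < r -> 0 <= d -> d <= sin w -> r <= d * cos w * sin w ->
  ((k%:R^-1 * (k%:R * (r ^+ 2 * (2 * (sin w - d))) - n%:R * (4 / 3 * r ^+ 3)))%:E <=
   \int[polygon_measure R k]_x (min_sq_dist k alpha x)%:E)%E.
Proof.
move=> an r0 d0 dw rd.
rewrite integral_polygon; last 2 first.
- by apply/measurable_EFinP; exact: measurable_min_sq_dist.
- by move=> x; rewrite lee_fin min_sq_dist_ge0.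
rewrite EFinM lee_pmul2l ?lte_fin ?invr_gt0 ?ltr0n ?(leq_trans _ k3)//.
set A := (alpha `|` vertices R k)%fset.
rewrite EFinB leeBlDr//.
pose T : interval R := `[d, 2 * sin w - d].
have mT : measurable [set` T] by exact: measurable_itv.
have mmin i (D : set (measurableTypeR R)) :
    measurable_fun D (fun s => (min_sq_dist k alpha (side k i s))%:E).
  exact: measurable_comp_side (measurable_min_sq_dist _).
have mbump a i (D : set (measurableTypeR R)) :
    measurable_fun D (fun s => (bump r a (side k i s))%:E).
  exact: measurable_comp_side (measurable_bump _ _).
apply: (@le_trans _ _ (\sum_(i < k) \int[lebesgue]_(s in [set` T]) (r ^+ 2)%:E)%E).
  have -> : (\int[lebesgue]_(s in [set` T]) (r ^+ 2)%:E =
             (r ^+ 2 * (2 * (sin w - d)))%:E)%E.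
    rewrite integral_cst//= lebesgue_measure_itv/= lte_fin -EFinB.
    (* In the remaining case the trimmed side is the single point [d = sin w], and both sides
       vanish. *)
    case: ltP => dd; first by rewrite -EFinM; congr EFin; ring.
    have -> : sin w = d by lra.
    by rewrite subrr !mulr0 mule0.
  by rewrite sumEFin sumr_const card_ord mulr_natl.
apply: (@le_trans _ _ (\sum_(i < k) (\int[lebesgue]_(s in [set` T])
    (min_sq_dist k alpha (side k i s))%:E + \sum_(a <- A) \int[lebesgue]_(s in [set` T])
    (bump r a (side k i s))%:E))%E).
  apply: lee_sum => i _.
  rewrite -ge0_integral_sum//; last by move=> a s _; rewrite lee_fin bump_ge0.
  rewrite -ge0_integralD//; last 3 first.
  - by move=> s _; rewrite lee_fin min_sq_dist_ge0.
  - by move=> s _; apply: sume_ge0 => a _; rewrite lee_fin bump_ge0.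
  - exact: emeasurable_sum.
  apply: ge0_le_integral => //.
  - by move=> s _; rewrite lee_fin sqr_ge0.
  - by apply: emeasurable_funD => //; exact: emeasurable_sum.
  - by move=> s _; rewrite sumEFin lee_fin le_min_sq_distD_bump.
(* The minimum is nonnegative, so its integral grows from the trimmed to the full sides. Exchanging
   the sums collects the bumps of one point over all sides, as [sum_integral_bump_le] expects. *)
rewrite big_split/= exchange_big/=; apply: leeD.
  apply: lee_sum => i _; apply: ge0_subset_integral => //.
  - by move=> s _; rewrite lee_fin min_sq_dist_ge0.
  - by apply: subset_itvScc; rewrite bnd_simp; lra.
apply: (@le_trans _ _ (\sum_(a <- A) (4 / 3 * r ^+ 3)%:E)%E).
  by apply: lee_sum => a _; exact: sum_integral_bump_le.
rewrite sumEFin big_const_seq count_predT iter_addr_0 lee_fin.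
rewrite -[leLHS]mulr_natl.
apply: ler_wpM2r; first by rewrite mulr_ge0// exprn_ge0// ltW.
(* The number of bumps is at most that of the free points plus the [k] vertices, hence at most
   [n]. *)
rewrite ler_nat (leq_trans _ an)// (leq_trans (leq_card_fsetU _ _))//.
by rewrite leq_add2l card_vertices.
Qed.

(** * Upper bound on the error by midpoints of equal cells *)

Lemma integral_cells_le (f : R -> R) (c : R) (M : nat) : 0 < c ->
  measurable_fun [set: R] f -> (forall s, 0 <= f s) ->
  (forall q s, (q < M)%N -> s \in `[q%:R * c, q.+1%:R * c] ->
    f s <= (s - (q%:R + 2^-1) * c) ^+ 2) ->
  (\int[lebesgue]_(s in `[0%R, (M%:R * c)%R]) (f s)%:E <=
     (M%:R * (c ^+ 3 / 12))%:E)%E.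
Proof.
move=> c0 mf f0; elim: M => [|M ih] fle.
  by rewrite !mul0r set_itv1 integral_set1.
have mfE (D : set R) : measurable_fun D (EFin \o f).
  by apply/measurable_EFinP; exact: measurable_funTS.
have cM : M%:R * c <= M.+1%:R * c by rewrite ler_pM2r// ler_nat.
rewrite (@itv_bndbnd_setU _ _ (BLeft 0) (BRight (M%:R * c))); last 2 first.
- by rewrite bnd_simp mulr_ge0// ltW.
- by rewrite bnd_simp.
rewrite ge0_integral_setU//=; last 3 first.
- exact: mfE.
- by move=> s _; rewrite lee_fin.
- apply/disj_setPS => s [/=]; rewrite !in_itv/= => /andP[_ h] /andP[h' _].
  by have := lt_le_trans h' h; rewrite ltxx.
have -> : M.+1%:R * (c ^+ 3 / 12) = M%:R * (c ^+ 3 / 12) + c ^+ 3 / 12.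
  by rewrite -natr1 mulrDl mul1r.
rewrite EFinD; apply: leeD.
  by apply: ih => q s qM; apply: fle; rewrite ltnS ltnW.
(* Adding the null left endpoint turns the last piece into the closed cell on which [fle]
   applies. *)
rewrite integral_itv_obnd_cbnd; last exact: mfE.
apply: (@le_trans _ _ (\int[lebesgue]_(s in `[(M%:R * c)%R, (M.+1%:R * c)%R])
   ((s - (M%:R + 2^-1) * c) ^+ 2)%:E)%E).
  apply: ge0_le_integral => //.
  - by move=> s _; rewrite lee_fin.
  - exact: mfE.
  - apply/measurable_EFinP; apply: measurable_funTS; apply: measurable_funX.
    exact: measurable_funB.
  - by move=> s /= sM; rewrite lee_fin; exact: fle.
(* The center is the midpoint of the cell, so the integral is [2 * (c / 2) ^ 3 / 3 = c ^ 3 / 12]. *)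
rewrite integral_sqr_sub; last by rewrite ltr_pM2r// ltr_nat.
by rewrite lee_fin -natr1 le_eqVlt; apply/orP; left; apply/eqP; field.
Qed.

Lemma euclid_sqr_same_side i (s t : R) :
  euclid (side k i s) (side k i t) ^+ 2 = (s - t) ^+ 2.
Proof.
rewrite euclid_sqr !sideE//=.
rewrite -[RHS]mulr1 -[X in _ = _ * X](cos2Dsin2 (mid_angle R k i)).
by ring.
Qed.

Definition cell_centers (M : nat) : {fset (R * R)} :=
  [fset x in [seq side k i ((q%:R + 2^-1) * (2 * sin w / M%:R))
             | i <- iota 0 k, q <- iota 0 M]]%fset.

Lemma card_cell_centers M : (#|` cell_centers M| <= k * M)%N.
Proof.
by rewrite card_fseq (leq_trans (size_undup _))// size_allpairs !size_iota.
Qed.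

(** On each side only its own centers are used: [M] cells of length [c = 2 * sin w / M] contribute
    [M * c ^ 3 / 12]. The sum over the [k] sides cancels the density [1 / k]. *)
Lemma integral_cell_centers_le M : (0 < M)%N ->
  (\int[polygon_measure R k]_x (min_sq_dist k (cell_centers M) x)%:E <=
   ((2 * sin w) ^+ 3 / (12 * M%:R ^+ 2))%:E)%E.
Proof.
move=> M0; have MR : (0 : R) < M%:R by rewrite ltr0n.
have kR : (0 : R) < k%:R by rewrite ltr0n (leq_trans _ k3).
have s0 := sin_half_angle_gt0 R k3.
rewrite integral_polygon; last 2 first.
- by apply/measurable_EFinP; exact: measurable_min_sq_dist.
- by move=> x; rewrite lee_fin min_sq_dist_ge0.
set B := (_ / _ : R).
apply: (@le_trans _ _ ((k%:R^-1)%:E * \sum_(i < k) B%:E)%E); last first.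
  rewrite sumEFin sumr_const card_ord -EFinM lee_fin.
  by rewrite -[B *+ k]mulr_natl mulrA mulVf ?mul1r// gt_eqF.
rewrite lee_pmul2l ?lte_fin ?invr_gt0//.
apply: lee_sum => i _.
pose c := 2 * sin w / M%:R.
have -> : 2 * sin w = M%:R * c by rewrite /c; field; rewrite gt_eqF.
have -> : B = M%:R * (c ^+ 3 / 12) by rewrite /B /c; field; rewrite gt_eqF.
apply: (@integral_cells_le (fun s => min_sq_dist k (cell_centers M) (side k i s))).
- by rewrite divr_gt0// mulr_gt0.
- by apply: (measurableT_comp (measurable_min_sq_dist _)); exact: measurable_side.
- by move=> s; exact: min_sq_dist_ge0.
move=> q s qM _; rewrite -(euclid_sqr_same_side i); apply: min_sq_dist_le.
rewrite inE/=; apply/allpairsP; exists (i : nat, q) => /=.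
by rewrite !mem_iota/= !add0n; split.
Qed.

(** The number [k * M.+1] counts [M] centers per side together with the [k] vertices. The two bounds
    also make the infimum finite, so [fine] does not alter it. *)
Lemma cond_quant_error_bounds n M r d : (0 < M)%N -> (k * M.+1 <= n)%N ->
  0 < r -> 0 <= d -> d <= sin w -> r <= d * cos w * sin w ->
  k%:R^-1 * (k%:R * (r ^+ 2 * (2 * (sin w - d))) - n%:R * (4 / 3 * r ^+ 3)) <=
  cond_quant_error R k n <= (2 * sin w) ^+ 3 / (12 * M%:R ^+ 2).
Proof.
move=> M0 kMn r0 d0 dw rd; rewrite /cond_quant_error.
set LB := (X in X <= fine _); set UB := (X in fine _ <= X).
set I := ereal_inf _.
have kn : (k <= n)%N by rewrite (leq_trans _ kMn)// leq_pmulr.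
have LI : (LB%:E <= I)%E.
  apply: le_ereal_inf_tmp => _ [alpha /= an <-].
  apply: integral_min_sq_dist_ge => //.
  by rewrite -(subnK kn) leq_add2r.
have IU : (I <= UB%:E)%E.
  apply: ge_ereal_inf; exists (\int[polygon_measure R k]_x
    (min_sq_dist k (cell_centers M) x)%:E)%E; last exact: integral_cell_centers_le.
  exists (cell_centers M) => //=.
  by rewrite (leq_trans (card_cell_centers M))// leq_subRL// -mulnS.
have If : I \is a fin_num.
  by rewrite fin_numElt (lt_le_trans _ LI) ?ltNyr// (le_lt_trans IU) ?ltry.
by rewrite -!lee_fin fineK// LI IU.
Qed.

End PolygonIntegral.

(** * Asymptotics in n and the dimension *)

Section Asymptotics.
Variables (R : realType) (k : nat).
Hypothesis k3 : (3 <= k)%N.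
Local Notation w := (half_angle R k).
Local Notation V := (cond_quant_error R k).

Lemma cvg_natrV : (n%:R^-1 : R) @[n --> \oo] --> (0 : R).
Proof.
apply/gtr0_cvgV0; last exact: cvgr_idn.
by near=> n; rewrite ltr0n; near: n; exact: nbhs_infty_gt.
Unshelve. all: by end_near.
Qed.

Lemma cond_quant_error_squeeze :
  \forall n \near \oo,
    2 / 3 * k%:R ^+ 2 * (sin w - k%:R / cos w * n%:R^-1) ^+ 3 <=
    n%:R ^+ 2 * V n <=
    2 / 3 * k%:R ^+ 2 * sin w ^+ 3 * (1 - 2 * k%:R * n%:R^-1) ^- 2.
Proof.
have s0 := sin_half_angle_gt0 R k3; have c0 := cos_half_angle_gt0 R k3.
have k0 : (0 : R) < k%:R by rewrite ltr0n (leq_trans _ k3).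
near=> n.
have n2k : (2 * k < n)%N by near: n; exact: nbhs_infty_gt.
have n0 : (0 : R) < n%:R by rewrite ltr0n (leq_ltn_trans _ n2k).
(* With this trimming [d * cos w * sin w = k * sin w / n], which dominates the [r] chosen below. *)
pose d := k%:R / cos w * n%:R^-1.
have ds : d < sin w.
  rewrite /d ltr_pdivrMr// -ltr_pdivrMl// mulrC.
  by near: n; exact: nbhs_infty_gtr.
have d0 : 0 <= d by rewrite mulr_ge0 ?invr_ge0 ?divr_ge0// ltW.
(* This [r] maximizes the lower bound [2 * (sin w - d) * r ^ 2 - 4 * n * r ^ 3 / (3 * k)]. *)
pose r := k%:R * (sin w - d) / n%:R.
(* The largest [M] with [k * M.+1 <= n]; it is positive because [2 * k < n], and
   [M * k >= n - 2 * k]. *)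
pose M := (n %/ k).-1.
have q1 : (1 < n %/ k)%N by rewrite leq_divRL ?(leq_trans _ k3)// ltnW.
have M0 : (0 < M)%N by rewrite -ltnS prednK// ltnW.
have M1 : M.+1 = (n %/ k)%N by rewrite prednK// ltnW.
have := @cond_quant_error_bounds R k k3 n M r d M0.
move=> /(_ _ _ d0 (ltW ds)) => /(_ _ _ _)/andP[].
- by rewrite M1 mulnC leq_trunc_div.
- by rewrite divr_gt0// mulr_gt0// subr_gt0.
- rewrite /r {2}/d.
  have -> : k%:R / cos w / n%:R * cos w * sin w = k%:R * sin w / n%:R.
    by field; rewrite !gt_eqF.
  by rewrite ler_pM2r ?invr_gt0// ler_pM2l// gerBl.
rewrite -/d => lo up; apply/andP; split.
  have -> : 2 / 3 * k%:R ^+ 2 * (sin w - d) ^+ 3 = n%:R ^+ 2 *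
     (k%:R^-1 * (k%:R * (r ^+ 2 * (2 * (sin w - d))) - n%:R * (4 / 3 * r ^+ 3))).
    by rewrite /r; field; rewrite !gt_eqF.
  by rewrite ler_pM2l// exprn_gt0.
apply: (le_trans (ler_wpM2l (exprn_ge0 _ (ltW n0)) up)).
have nM : (n%:R - 2 * k%:R : R) <= M%:R * k%:R.
  rewrite lerBlDr -!natrM -natrD ler_nat -mulnDl addn2 M1 mulSn addnC.
  by rewrite {1}(divn_eq n k) leq_add2l ltnW// ltn_pmod// (leq_trans _ k3).
have a0 : 0 < n%:R - 2 * k%:R :> R by rewrite subr_gt0 -natrM ltr_nat.
have MR : (0 : R) < M%:R by rewrite ltr0n.
have -> : 2 / 3 * k%:R ^+ 2 * sin w ^+ 3 * (1 - 2 * k%:R * n%:R^-1) ^- 2 =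
   n%:R ^+ 2 * (2 * sin w) ^+ 3 / 12 * (k%:R ^+ 2 / (n%:R - 2 * k%:R) ^+ 2).
  by field; rewrite !gt_eqF//.
have -> : n%:R ^+ 2 * ((2 * sin w) ^+ 3 / (12 * M%:R ^+ 2)) =
   n%:R ^+ 2 * (2 * sin w) ^+ 3 / 12 * (M%:R ^+ 2)^-1.
  by field; rewrite gt_eqF.
apply: ler_wpM2l; first by rewrite !mulr_ge0 ?invr_ge0// ?exprn_ge0// ?mulr_ge0// ltW.
rewrite ler_pdivlMr ?exprn_gt0// mulrC ler_pdivrMr ?exprn_gt0// -exprMn.
by rewrite [k%:R * M%:R]mulrC lerXn2r ?nnegrE ?mulr_ge0// ltW.
Unshelve. all: by end_near.
Qed.

Lemma cvg_sqr_cond_quant_error :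
  n%:R ^+ 2 * V n @[n --> \oo] --> 2 / 3 * k%:R ^+ 2 * sin w ^+ 3.
Proof.
have exprcvg (a b : R) m : (a - b * n%:R^-1) ^+ m @[n --> \oo] --> (a - b * 0) ^+ m.
  apply: (@cvg_comp _ _ _ _ (fun y : R => y ^+ m)); last exact: exprn_continuous.
  apply: cvgB; first exact: cvg_cst.
  by apply: cvgM; [exact: cvg_cst|exact: cvg_natrV].
apply: (squeeze_cvgr cond_quant_error_squeeze).
- apply: cvgM; first exact: cvg_cst.
  by have := exprcvg (sin w) (k%:R / cos w) 3; rewrite mulr0 subr0.
- rewrite -[X in _ --> X]mulr1.
  apply: cvgM; first exact: cvg_cst.
  rewrite -[X in _ --> X]invr1; apply: cvgV; first by rewrite oner_neq0.
  by have := exprcvg 1 (2 * k%:R) 2; rewrite mulr0 subr0 expr1n.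
Qed.

Lemma cond_quant_coef_gt0 : 0 < 2 / 3 * k%:R ^+ 2 * sin w ^+ 3.
Proof.
have k0 : (0 : R) < k%:R by rewrite ltr0n (leq_trans _ k3).
have s0 := sin_half_angle_gt0 R k3.
by rewrite mulr_gt0 ?exprn_gt0// mulr_gt0 ?exprn_gt0// divr_gt0.
Qed.

Lemma cvg_cond_quant_error : V n @[n --> \oo] --> (0 : R).
Proof.
have : n%:R ^+ 2 * V n * (n%:R^-1 * n%:R^-1) @[n --> \oo] -->
    2 / 3 * k%:R ^+ 2 * sin w ^+ 3 * (0 * 0).
  apply: cvgM; first exact: cvg_sqr_cond_quant_error.
  by apply: cvgM; exact: cvg_natrV.
rewrite !mulr0; apply: cvg_trans; apply: near_eq_cvg; near=> n.
have n0 : n%:R != 0 :> R by rewrite pnatr_eq0 -lt0n; near: n; exact: nbhs_infty_gt.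
by field.
Unshelve. all: by end_near.
Qed.

Lemma cvg_lnn : ln n%:R @[n --> \oo] --> (+oo : set_system R).
Proof.
apply/cvgryPge => A; near=> n.
have An : expR A <= n%:R by near: n; exact: nbhs_infty_ger.
by rewrite -[A]expRK ler_ln// posrE ?expR_gt0// (lt_le_trans (expR_gt0 A)).
Unshelve. all: by end_near.
Qed.

(** Since [ln (n ^ 2 * V n)] converges while [ln n] diverges, their quotient tends to 0. With
    [V_inf = 0], the sequence is eventually the inverse of 1 minus half that quotient. *)
Lemma cvg_cond_quant_dim_seq : cond_quant_dim_seq R k n @[n --> \oo] --> (1 : R).
Proof.
set C : R := 2 / 3 * k%:R ^+ 2 * sin w ^+ 3.
have lnC : ln (n%:R ^+ 2 * V n) @[n --> \oo] --> ln C.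
  apply: (@cvg_comp _ _ _ _ (@ln R)); first exact: cvg_sqr_cond_quant_error.
  exact: continuous_ln cond_quant_coef_gt0.
have lnV : (ln n%:R : R)^-1 @[n --> \oo] --> (0 : R).
  apply/gtr0_cvgV0; last exact: cvg_lnn.
  by near=> n; rewrite ln_gt0// ltr1n; near: n; exact: nbhs_infty_gt.
have : (1 - ln (n%:R ^+ 2 * V n) * (ln n%:R)^-1 * 2^-1)^-1 @[n --> \oo] -->
    (1 - ln C * 0 * 2^-1)^-1.
  apply: cvgV; first by rewrite mulr0 mul0r subr0 oner_neq0.
  apply: cvgB; first exact: cvg_cst.
  by apply: cvgM; [exact: cvgM|exact: cvg_cst].
rewrite mulr0 mul0r subr0 invr1; apply: cvg_trans; apply: near_eq_cvg; near=> n.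
rewrite /cond_quant_dim_seq /cond_quant_error_lim (cvg_lim _ cvg_cond_quant_error)//.
rewrite subr0.
have n1 : (1 : R) < n%:R by rewrite ltr1n; near: n; exact: nbhs_infty_gt.
have n0 : (0 : R) < n%:R by rewrite (lt_trans _ n1).
(* Positivity of the limit makes [V n] eventually positive, so the logarithm of the product
   splits. *)
have x0 : 0 < n%:R ^+ 2 * V n.
  by near: n; exact: cvgr_gt cvg_sqr_cond_quant_error _ cond_quant_coef_gt0.
have V0 : 0 < V n by move: x0; rewrite pmulr_rgt0// exprn_gt0.
have lnn0 : 0 < ln (n%:R : R) by rewrite ln_gt0.
have lnE : ln (n%:R ^+ 2 * V n) = 2 * ln n%:R + ln (V n).
  by rewrite lnM ?posrE ?exprn_gt0// lnXn// mulr_natl.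
rewrite lnE.
have -> : 1 - (2 * ln n%:R + ln (V n)) / ln n%:R * 2^-1 = - ln (V n) / (2 * ln n%:R).
  by field; rewrite gt_eqF.
by rewrite invf_div.
Unshelve. all: by end_near.
Qed.

End Asymptotics.

Theorem theorem3p10 (R : realType) (k : nat) (hk : (3 <= k)%N) :
  let V := @cond_quant_error R k in
  let Vinf := @cond_quant_error_lim R k in
  let D := @cond_quant_dim R k in
  let C : R := 2 / 3 * k%:R ^+ 2 * sin (pi / k%:R) ^+ 3 in
  [/\ cvgn V,
      cvgn (@cond_quant_dim_seq R k) /\ D = 1,
      n%:R `^ (2 / D) * (V n - Vinf) @[n --> \oo] --> C,
      n%:R ^+ 2 * (V n - Vinf) @[n --> \oo] --> C
    & 0 < C].
Proof.
move=> V Vinf D C.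
have Vinf0 : Vinf = 0 by apply: cvg_lim => //; exact: cvg_cond_quant_error.
have D1 : D = 1 by apply: cvg_lim => //; exact: cvg_cond_quant_dim_seq.
have cvgC : n%:R ^+ 2 * (V n - Vinf) @[n --> \oo] --> C.
  under eq_fun do rewrite Vinf0 subr0.
  exact: cvg_sqr_cond_quant_error.
split => //.
- by apply/cvg_ex; exists 0; exact: cvg_cond_quant_error.
- by split => //; apply/cvg_ex; exists 1; exact: cvg_cond_quant_dim_seq.
- under eq_fun do rewrite D1 divr1 powR_mulrn//.
  exact: cvgC.
- exact: cond_quant_coef_gt0.
Qed.
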